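(* Let $\Gamma=\mathbb{Z}_{n_1}\oplus \mathbb{Z}_{n_2}\oplus\cdots \oplus \mathbb{Z}_{n_r}$ (each $n_s\ge 2$) be a finite abelian group of order $|\Gamma|=n_1n_2\cdots n_r$, and let $S\subseteq\Gamma$ satisfy $0\notin S$ and $-S=S$. Let $v\in\Gamma$, $a=(a_1,\ldots,a_r)\in\Gamma$, $t\in\mathbb{R}$, let $n=(n_1,\ldots,n_r)$ and $$N=\left\{(x,y)\ \middle|\ x,y\in \Gamma,\ x\mathrel{\dot>}y,\ \mathrm{wt}\left(\frac{2a(x-y)}{n}\right)\text{ is even}\right\}.$$ Then $\mathrm{Cay}(\Gamma,S)$ has fractional revival at time $t$ between the vertices $v$ and $v+a$ if and only if the following three conditions hold: (a) $a=(a_1,\ldots,a_r)$ is of order two; (b) $n_s$ is even for $a_s\neq 0$, $s=1,2,\ldots,r$; (c) $\frac{t}{2\pi}(\lambda_x-\lambda_y)\in\mathbb{Z}$ for all $(x,y)\in N$, where $\lambda_x=\sum_{g\in S}\prod_{s=1}^r e^{\frac{2\pi \mathrm{i}}{n_s}x_sg_s}$. Moreover, if these conditions hold, and $\lambda_x-\lambda_y$ are integers for all $(x,y)\in N$, then there is a minimum positive time $t=\frac{2\pi}{M}$ at which fractional revival occurs between $v$ and $v+a$, where $$M=\gcd(\{\lambda_x-\lambda_y\}_{(x,y)\in N}).$$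
   Context: $\mathbb{Z}_m=\{0,1,\ldots,m-1\}$ is the additive group of integers modulo $m$. The Cayley graph $\mathrm{Cay}(\Gamma,S)$ has vertex set $\Gamma$, with $u,v$ adjacent if and only if $u-v\in S$. For a graph $G$ with adjacency matrix $A_G$, the transition matrix is $H_{A_G}(t)=\exp(\mathrm{i}tA_G)$, $t\in\mathbb{R}$, and $\mathbf{e}_u$ is the standard basis vector indexed by the vertex $u$. For distinct vertices $u,v$, $G$ has fractional revival at time $t$ from $u$ to $v$ if $H_{A_G}(t)\mathbf{e}_u=\alpha\mathbf{e}_u+\beta\mathbf{e}_v$ for some complex numbers $\alpha,\beta$ with $|\alpha|^2+|\beta|^2=1$ (equivalently $|H_{A_G}(t)_{u,u}|^2+|H_{A_G}(t)_{u,v}|^2=1$); the cases $\alpha=0$ (perfect state transfer) and $\beta=0$ (periodicity at $u$) are included. Fractional revival from $u$ to $v$ at time $t$ implies fractional revival from $v$ to $u$ at time $t$, so one speaks of fractional revival between $u$ and $v$. For $x=(x_1,\ldots,x_r),y=(y_1,\ldots,y_r)\in\Gamma$, with coordinates regarded as integers $0\le x_s,y_s\le n_s-1$, $x\mathrel{\dot>}y$ means that there is $i\in\{1,\ldots,r\}$ with $x_1=y_1,\ldots,x_{i-1}=y_{i-1}$ and $x_i>y_i$. The notation $\mathrm{wt}$ denotes the sum of all coordinates of a tuple, with products and quotients of tuples taken coordinatewise; thus $\mathrm{wt}\left(\frac{2a(x-y)}{n}\right)=\sum_{s=1}^r\frac{2a_s(x_s-y_s)}{n_s}$, a rational number computed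 with integer representatives; ''is even'' means it is an even integer.
   Formalization: The equivalence is stated except when the graph is periodic at v at time t and 2a≠0 (there revival holds trivially with β=0 but (a) fails, e.g. t=0, Z_3, a=1); the minimum-time claim assumes M≠0 (for K_2, N is empty, M=0 and no minimum positive time exists). *)

(* Defs.v *)
From HB Require Import structures.
From mathcomp Require Import all_boot all_order all_fingroup all_algebra.
From mathcomp Require Import complex.
From mathcomp Require Import all_classical all_reals all_analysis.

Set Implicit Arguments.
Unset Strict Implicit.
Unset Printing Implicit Defensive.

Import Order.TTheory GRing.Theory Num.Theory.
Import numFieldNormedType.Exports.

Local Open Scope ring_scope.
Local Open Scope complex_scope.

(* The alias hides the group that fingroup puts on dependent finite functions,
   so that the group below is the one induced by addition. ['Z_m] is the ring
   of integers modulo m only for 1 < m. *)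
Definition zsum (r : nat) (n : 'I_r -> nat) : Type :=
  {dffun forall s : 'I_r, 'Z_(n s)}.

Section ZsumGroup.
Context (r : nat) (n : 'I_r -> nat).

HB.instance Definition _ := Finite.on (zsum n).

Definition zsum_zero : zsum n := [ffun s => 0 : 'Z_(n s)].
Definition zsum_opp (x : zsum n) : zsum n := [ffun s => - x s : 'Z_(n s)].
Definition zsum_add (x y : zsum n) : zsum n :=
  [ffun s => x s + y s : 'Z_(n s)].

Fact zsum_addA : associative zsum_add.
Proof. by move=> x y z; apply/ffunP => s; rewrite !ffunE addrA. Qed.
Fact zsum_addC : commutative zsum_add.
Proof. by move=> x y; apply/ffunP => s; rewrite !ffunE addrC. Qed.
Fact zsum_add0 : left_id zsum_zero zsum_add.
Proof. by move=> x; apply/ffunP => s; rewrite !ffunE add0r. Qed.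
Fact zsum_addN : left_inverse zsum_zero zsum_opp zsum_add.
Proof. by move=> x; apply/ffunP => s; rewrite !ffunE addNr. Qed.

HB.instance Definition _ :=
  GRing.isZmodule.Build (zsum n) zsum_addA zsum_addC zsum_add0 zsum_addN.
HB.instance Definition _ := [finGroupMixin of zsum n for +%R].

End ZsumGroup.

Definition Cay (G : finZmodType) (S : {set G}) : rel G :=
  fun u v => u - v \in S.

Section QuantumWalk.
Context (R : realType).

(* [R[i]^o] is R[i], seen with the topology of its norm. *)
Definition expmx (m : nat) (A : 'M[R[i]]_m) : 'M[R[i]]_m :=
  \matrix_(i, j)
    limn (series (fun k => (k`!%:R^-1 * (A ^+ k) i j : R[i]^o))).

Section Graph.
Context (T : finType) (e : rel T).

Definition adjmx : 'M[R[i]]_#|T| :=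
  \matrix_(i, j) (e (enum_val i) (enum_val j))%:R.

Definition transition (t : R) : 'M[R[i]]_#|T| := expmx ((0 +i* t) *: adjmx).

Definition vertex_vec (u : T) : 'cV[R[i]]_#|T| := delta_mx (enum_rank u) 0.

Definition fractional_revival (t : R) (u v : T) : Prop :=
  u <> v /\
  exists alpha beta : R[i],
    `|alpha| ^+ 2 + `|beta| ^+ 2 = 1 /\
    transition t *m vertex_vec u
      = alpha *: vertex_vec u + beta *: vertex_vec v.

Definition periodic_at (t : R) (u : T) : Prop :=
  exists alpha : R[i],
    `|alpha| = 1 /\ transition t *m vertex_vec u = alpha *: vertex_vec u.

End Graph.

Definition expi (theta : R) : R[i] := cos theta +i* sin theta.

Definition cay_eigenvalue (r : nat) (n : 'I_r -> nat) (S : {set zsum n})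
    (x : zsum n) : R[i] :=
  \sum_(g in S) \prod_(s < r)
    expi (2 * pi / (n s)%:R * (x s : nat)%:R * (g s : nat)%:R).

End QuantumWalk.

Definition even_integer (q : rat) : bool :=
  (q \is a Num.int) && (2 %| numq q)%Z.

Section PairSet.
Context (r : nat) (n : 'I_r -> nat).

Definition dotgt (x y : zsum n) : bool :=
  [exists i : 'I_r,
    [forall j : 'I_r, (j < i)%N ==> (x j == y j)] && (y i < x i)%N].

Definition wt (q : 'I_r -> rat) : rat := \sum_(s < r) q s.

Definition Npairs (a : zsum n) : {set zsum n * zsum n} :=
  [set p | dotgt p.1 p.2 &
    even_integer (wt (fun s =>
      2 * (a s : nat)%:R * ((p.1 s : nat)%:R - (p.2 s : nat)%:R)
        / (n s)%:R))].

End PairSet.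

(* Main.v *)
(* The characters chi_x diagonalise the adjacency matrix, so the (w, v) entry of
   exp(itA) is the inverse Fourier transform of x |-> e^{it lambda_x} at w - v.
   Hence fractional revival from v to v + a amounts to
   e^{it lambda_x} = alpha + beta chi_x(-a) for all x.  When 2a = 0, chi_x(a) is
   the sign (-1)^{sum of the x_s with a_s <> 0}, and N consists of the pairs
   x >. y with chi_x(a) = chi_y(a); so revival says exactly that
   e^{it lambda_x} is constant on each of the two level sets of that sign, the
   two values p, q giving alpha = (p + q)/2 and beta = (p - q)/2.  By Bezout,
   the times t with (t/2pi) d integral for all differences d are the multiples
   of 2pi/M. *)
Require Import Defs.
From HB Require Import structures.
From mathcomp Require Import all_boot all_order all_fingroup all_algebra.
From mathcomp Require Import complex.
From mathcomp Require Import all_classical all_reals all_analysis.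
From mathcomp Require Import zify ring lra.
Import Order.TTheory GRing.Theory Num.Theory.
Import numFieldNormedType.Exports.
Local Open Scope ring_scope.
Local Open Scope complex_scope.

Set Implicit Arguments.
Unset Strict Implicit.
Unset Printing Implicit Defensive.

(** * The exponential series on the imaginary axis, and entries of a matrix exponential *)

Lemma cvg_complex (R : realType) (u v : nat -> R) (a b : R) :
  (u @ \oo --> a)%classic -> (v @ \oo --> b)%classic ->
  ((fun k => u k +i* v k : R[i]^o) @ \oo --> (a +i* b : R[i]^o))%classic.
Proof.
(* A positive element of [R[i]] has zero imaginary part, so the radius is a real [e], and each
   coordinate gets [e / 2]. *)
move=> cu cv; apply/cvgrPdist_lt => -[e e'] /[!ltcE] /= /andP[/eqP-> e_gt0].
have e2_gt0 : 0 < e / 2 by lra.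
near=> k.
have ku : `|a - u k| < e / 2 by near: k; move/cvgrPdist_lt: cu; exact.
have kv : `|b - v k| < e / 2 by near: k; move/cvgrPdist_lt: cv; exact.
have -> : (a +i* b) - (u k +i* v k) = (a - u k)%:C + 'i * (b - v k)%:C :> R[i].
  by rewrite [LHS]complexE.
apply: le_lt_trans (ler_normD _ _) _.
rewrite normrM !normc_def /= !expr0n /= !addr0 !add0r !expr1n !sqrtr_sqr sqrtr1.
by rewrite mul1r -rmorphD ltcR /=; lra.
Unshelve. all: by end_near.
Qed.

(** The parity factors and the halves [k./2], [k.-1./2] follow the shape of [cos_coeff] and
    [sin_coeff], so that the exponential series splits into the cosine and sine series. *)
Lemma expr_imaginary (R : realType) (th : R) k :
  (0 +i* th) ^+ k = ((~~ odd k)%:R * (-1) ^+ k./2 * th ^+ k)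
                 +i* ((odd k)%:R * (-1) ^+ k.-1./2 * th ^+ k).
Proof.
elim: k => [|k IH]; first by rewrite !expr0 /= !mul1r !mul0r.
rewrite exprS {}IH; apply/eqP; rewrite eq_complex /= !mul0r !add0r.
rewrite uphalf_half; case: k => [|k] /=.
  by rewrite !expr0; apply/andP; split; apply/eqP; ring.
rewrite uphalf_half negbK; case: (odd k); rewrite /= ?add0n ?add1n !exprS;
  by apply/andP; split; apply/eqP; ring.
Qed.

Lemma cvg_exp_imaginary (R : realType) (th : R) :
  (series (fun k => (k`!%:R^-1 * (0 +i* th) ^+ k : R[i]^o)) @ \oo
     --> (expi th : R[i]^o))%classic.
Proof.
have -> : series (fun k => (k`!%:R^-1 * (0 +i* th) ^+ k : R[i]^o)) =
   fun k => series (cos_coeff th) k +i* series (sin_coeff th) k.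
  apply/funext => k; rewrite /series /=.
  elim: k => [|k IH]; first by rewrite !big_geq.
  rewrite !big_nat_recr //= {}IH expr_imaginary.
  have -> : (k`!%:R^-1 : R[i]) = (k`!%:R^-1)%:C by rewrite fmorphV rmorph_nat.
  rewrite /cos_coeff /sin_coeff; simpc.
  by congr (_ +i* _); congr (_ + _); rewrite /= ?exprnP; ring.
rewrite /expi cos.unlock sin.unlock; apply: cvg_complex.
  exact: is_cvg_series_cos_coeff.
exact: is_cvg_series_sin_coeff.
Qed.

Lemma cvg_bigsum (K : numFieldType) (V : normedModType K) (I : Type) (s : seq I)
    (f : I -> nat -> V) (l : I -> V) :
  (forall i, (f i @ \oo --> l i)%classic) ->
  ((fun k => \sum_(i <- s) f i k) @ \oo --> \sum_(i <- s) l i)%classic.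
Proof.
move=> fl; elim: s => [|i s IH].
  rewrite big_nil (_ : (fun _ => _) = fun=> 0); first exact: cvg_cst.
  by apply/funext => k; rewrite big_nil.
rewrite big_cons (_ : (fun _ => _) = f i \+ (fun k => \sum_(j <- s) f j k)).
  exact: cvgD.
by apply/funext => k; rewrite big_cons.
Qed.

(** A spectral decomposition with purely imaginary eigenvalues supplies the hypothesis; the finite
    sum over [x] then commutes with the limit of the series. *)
Lemma expmx_entry (R : realType) (m : nat) (A : 'M[R[i]]_m) (i j : 'I_m)
    (I : finType) (c : I -> R[i]) (th : I -> R) :
  (forall k, (A ^+ k) i j = \sum_x c x * (0 +i* th x) ^+ k) ->
  expmx A i j = \sum_x c x * expi (th x).
Proof.
move=> Aij; rewrite mxE.
apply: (@cvg_lim R[i]^o _ nat \oo%classic _ _ (\sum_x c x * expi (th x))).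
  exact: norm_hausdorff.
have -> : series (fun k => (k`!%:R^-1 * (A ^+ k) i j : R[i]^o)) = fun k =>
    \sum_x (c x *: series (fun l => (l`!%:R^-1 * (0 +i* th x) ^+ l : R[i]^o)) k).
  apply/funext => k; rewrite /series /=.
  under [RHS]eq_bigr do rewrite scaler_sumr.
  rewrite exchange_big; apply: eq_bigr => l _ /=.
  by rewrite Aij mulr_sumr; apply: eq_bigr => x _; rewrite /GRing.scale /= mulrCA.
by apply: cvg_bigsum => x; apply: cvgZr; exact: cvg_exp_imaginary.
Qed.

(** * The map from angles to the unit circle, and its kernel *)

Section Expi.
Context {R : realType}.
Implicit Types th : R.

Lemma expi0 : expi (0 : R) = 1.
Proof. by rewrite /expi cos0 sin0. Qed.

Lemma expiD th1 th2 : expi (th1 + th2) = expi th1 * expi th2.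
Proof.
rewrite /expi cosD sinD; apply/eqP; rewrite eq_complex /= eqxx /=.
by rewrite addrC.
Qed.

Lemma expiMn th k : expi (th *+ k) = expi th ^+ k.
Proof.
by elim: k => [|k IH]; rewrite ?mulr0n ?expi0 ?expr0 // mulrS expiD IH exprS.
Qed.

Lemma expi_conj th : (expi th)^* = expi (- th).
Proof. by rewrite /expi cosN sinN. Qed.

Lemma expi_normr th : `|expi th| = 1.
Proof. by rewrite normc_def /= cos2Dsin2 sqrtr1. Qed.

Lemma expiN th : expi (- th) = (expi th)^-1.
Proof.
have e0 : expi th != 0 by rewrite -normr_eq0 expi_normr oner_eq0.
by apply: (mulfI e0); rewrite -expiD subrr expi0 divff.
Qed.

Lemma expi_2pi : expi (2 * pi : R) = 1.
Proof. by rewrite mulr_natl /expi cos2pi sin2pi. Qed.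

Lemma expi_pi : expi (pi : R) = - 1.
Proof. by rewrite /expi cospi sinpi; apply/eqP; rewrite eq_complex /= oppr0 !eqxx. Qed.

Lemma expi_2piZ (k : int) : expi (2 * pi * k%:~R : R) = 1.
Proof.
case: k => k; first by rewrite -pmulrn mulr_natr expiMn expi_2pi expr1n.
by rewrite NegzE mulrNz mulrN expiN -pmulrn mulr_natr expiMn expi_2pi expr1n invr1.
Qed.

Lemma expi_eq1 th : expi th = 1 -> exists k : int, th = 2 * pi * k%:~R.
Proof.
move=> e1; have pi0 := pi_gt0 R.
(* The floor leaves a remainder [y] in [[0, 2pi)]. From [cos y = 1] follows [sin (y / 2) = 0], and
   sine is positive on []0, pi[], so [y = 0]. *)
set k := Num.floor (th / (2 * pi)); exists k.
have /andP[] := floor_itv (th / (2 * pi)).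
rewrite -/k rmorphD /= ler_pdivlMr ?ltr_pdivrMr; [|lra|lra] => k1 k2.
have : expi (th - 2 * pi * k%:~R) = 1 by rewrite expiD expiN expi_2piZ e1 invr1 mulr1.
set y := (th - _); have y0 : 0 <= y by rewrite /y; lra.
have y2 : y / 2 < pi by rewrite /y; lra.
rewrite (_ : y = (y / 2) *+ 2); last by rewrite -mulr_natr; lra.
case; rewrite cos_mulr2n => c _.
have s0 : sin (y / 2) = 0.
  by apply/eqP; rewrite -sqrf_eq0 sin2cos2; apply/eqP; move: c; rewrite -mulr_natr; lra.
suff: y = 0 by rewrite /y => /eqP; rewrite subr_eq0 => /eqP.
apply/eqP; rewrite eq_le y0 andbT leNgt; apply/negP => ypos.
suff: 0 < sin (y / 2) by rewrite s0 ltxx.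
by apply: sin_gt0_pi; rewrite y2 andbT; lra.
Qed.

End Expi.

Lemma expi_root1 (R : realType) (m : nat) :
  (0 < m)%N -> expi (2 * pi / m%:R : R) ^+ m = 1.
Proof.
by move=> m0; rewrite -expiMn -[_ *+ m]mulr_natr divfK ?expi_2pi // pnatr_eq0 -lt0n.
Qed.

Lemma expi_root_eq1 (R : realType) (m k : nat) :
  (0 < m)%N -> expi (2 * pi / m%:R : R) ^+ k = 1 -> (m %| k)%N.
Proof.
move=> m0; rewrite -expiMn => /expi_eq1[z].
have m1 : (m%:R : R) != 0 by rewrite pnatr_eq0 -lt0n.
have p0 : 2 * pi != 0 :> R by rewrite mulf_neq0 // gt_eqF // pi_gt0.
rewrite -[_ *+ k]mulr_natr => e.
have {}e : (k%:Z)%:~R = (m%:Z * z)%:~R :> R.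
  by rewrite rmorphM /=; apply: (mulfI p0); rewrite mulrCA -e -!pmulrn; field.
move/eqP: e; rewrite eqr_int => /eqP e.
by rewrite -[k]/`|k%:Z|%N e abszM dvdn_mulr.
Qed.

(** * Characters of the group, their orthogonality, Fourier inversion *)

Section Characters.
Context (R : realType) (r : nat) (n : 'I_r -> nat).
Hypothesis n_ge2 : forall s : 'I_r, (2 <= n s)%N.
Implicit Types (x y g h : zsum n) (s : 'I_r).

(** The inner product of [cay_eigenvalue]: each eigenvalue unfolds to the sum of a character over
    [S]. *)
Definition zsum_char x g : R[i] :=
  \prod_(s < r) expi (2 * pi / (n s)%:R * (x s : nat)%:R * (g s : nat)%:R).

(** With natural exponents on roots of unity, [expr_mod] absorbs the reduction modulo [n s] in the
    group law. *)
Lemma zsum_charE x g :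
  zsum_char x g = \prod_(s < r) expi (2 * pi / (n s)%:R) ^+ (x s * g s)%N.
Proof.
by apply: eq_bigr => s _; rewrite -expiMn -[_ *+ (_ * _)]mulr_natr natrM mulrA.
Qed.

Lemma val_zsumD g h s : ((g + h)%R s : nat) = ((g s + h s) %% n s)%N.
Proof. by rewrite ffunE; congr (_ %% _)%N; exact: Zp_cast. Qed.

Lemma zsum0E s : (0 : zsum n) s = 0.
Proof. by rewrite ffunE. Qed.

Lemma val_zsum_lt g s : (g s < n s)%N.
Proof. by rewrite -[X in (_ < X)%N](Zp_cast (n_ge2 s)). Qed.

Lemma zsum_charC x g : zsum_char x g = zsum_char g x.
Proof. by rewrite !zsum_charE; apply: eq_bigr => s _; rewrite mulnC. Qed.

Lemma zsum_charDr x g h :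
  zsum_char x (g + h) = zsum_char x g * zsum_char x h.
Proof.
rewrite !zsum_charE -big_split; apply: eq_bigr => s _ /=.
have e : expi (2 * pi / (n s)%:R : R) ^+ n s = 1.
  by rewrite expi_root1 // ltnW.
rewrite val_zsumD -exprD -mulnDr -(expr_mod (_ * (_ %% _)) e) modnMmr.
by rewrite expr_mod.
Qed.

Lemma zsum_char0r x : zsum_char x 0 = 1.
Proof. by rewrite zsum_charE big1 // => s _; rewrite zsum0E muln0. Qed.

Lemma zsum_charNr x g : zsum_char x (- g) = (zsum_char x g)^-1.
Proof.
have e : zsum_char x g * zsum_char x (- g) = 1.
  by rewrite -zsum_charDr subrr zsum_char0r.
have c0 : zsum_char x g != 0.
  by apply: contra_eq_neq e => ->; rewrite mul0r eq_sym oner_eq0.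
by apply: (mulfI c0); rewrite e divff.
Qed.

Lemma zsum_charNl x g : zsum_char (- x) g = zsum_char x (- g).
Proof. by rewrite zsum_charC zsum_charNr zsum_charC zsum_charNr. Qed.

Lemma zsum_charDl x y g :
  zsum_char (x + y) g = zsum_char x g * zsum_char y g.
Proof. by rewrite -!(zsum_charC g) zsum_charDr. Qed.

Lemma zsum_char_conj x g : (zsum_char x g)^* = zsum_char x (- g).
Proof.
rewrite zsum_charNr rmorph_prod -prodfV.
apply: eq_bigr => s _; rewrite -expiN; exact: expi_conj.
Qed.

Lemma zsum_char_neq1 x : x != 0 -> exists g, zsum_char x g != 1.
Proof.
move=> x0; have /existsP[s xs0] : [exists s, x s != 0].
  apply: contraNT x0 => /existsPn xs; apply/eqP/ffunP => s.
  by rewrite zsum0E; apply/eqP; move: (xs s); rewrite negbK.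
(* At the unit vector of coordinate [s] the character is [expi (2 * pi / n_s) ^+ x_s], which is 1
   only if [n_s] divides [x_s]. *)
exists [ffun s' => if s' == s then 1 else 0]; rewrite zsum_charE (bigD1 s) //=.
rewrite big1 => [|s' ss']; last by rewrite ffunE (negbTE ss') muln0.
rewrite mulr1 ffunE eqxx muln1; apply: contraNneq xs0 => /expi_root_eq1.
move=> /(_ (ltnW (n_ge2 s))) dv; apply/eqP/val_inj => /=; apply/eqP.
by apply: contraTT dv => xs0; rewrite gtnNdvd ?val_zsum_lt // lt0n.
Qed.

(** Translation by an [h] with [zsum_char x h != 1] permutes the terms and multiplies the sum by
    that value, so the sum vanishes when [x != 0]. *)
Lemma sum_zsum_char x : \sum_g zsum_char x g = #|{: zsum n}|%:R *+ (x == 0).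
Proof.
have [->|/zsum_char_neq1[h h1]] := eqVneq x 0.
  by under eq_bigr do rewrite zsum_charC zsum_char0r; rewrite sumr_const.
rewrite mulr0n; set A := \sum_g _.
have : zsum_char x h * A = A.
  rewrite mulr_sumr [RHS](reindex_inj (addrI h)) /=.
  by apply: eq_bigr => g _; rewrite zsum_charDr.
move/eqP; rewrite -subr_eq0 -{2}[A]mul1r -mulrBl mulf_eq0 subr_eq0.
by rewrite (negbTE h1) => /eqP.
Qed.

Lemma card_zsum_neq0 : #|{: zsum n}|%:R != 0 :> R[i].
Proof. by rewrite pnatr_eq0 -lt0n; apply/card_gt0P; exists 0. Qed.

Definition inv_fourier (f : zsum n -> R[i]) g : R[i] :=
  \sum_x #|{: zsum n}|%:R^-1 * zsum_char x g * f x.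

Lemma inv_fourierK f x : \sum_g inv_fourier f g * zsum_char x (- g) = f x.
Proof.
under eq_bigr do rewrite mulr_suml.
rewrite exchange_big (bigD1 x) //= [X in _ + X]big1 => [|y yx].
  rewrite addr0 (eq_bigr (fun=> #|{: zsum n}|%:R^-1 * f x)) => [|g _].
    by rewrite sumr_const -[_ *+ _]mulr_natl mulVKf // card_zsum_neq0.
  have e : zsum_char x g * zsum_char x (- g) = 1.
    by rewrite -zsum_charDr subrr zsum_char0r.
  by rewrite -[RHS]mulr1 -e; ring.
rewrite (eq_bigr (fun g => #|{: zsum n}|%:R^-1 * f y * zsum_char (y - x) g)).
  by rewrite -mulr_sumr sum_zsum_char subr_eq0 (negbTE yx) mulr0.
by move=> g _; rewrite zsum_charDl zsum_charNl; ring.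
Qed.

(** The function [al + be * zsum_char x (- a)] is the Fourier transform of point masses [al] at [0]
    and [be] at [a]. Inversion gives one direction, orthogonality the other. *)
Lemma inv_fourier_eq (f : zsum n -> R[i]) (al be : R[i]) (a : zsum n) :
  (forall g, inv_fourier f g = al * (g == 0)%:R + be * (g == a)%:R) <->
  (forall x, f x = al + be * zsum_char x (- a)).
Proof.
split => [Ff x|fE g].
  rewrite -inv_fourierK; under eq_bigr do rewrite Ff mulrDl.
  rewrite big_split /= (bigD1 0) //= big1 => [|g /negbTE->]; last by rewrite mulr0 mul0r.
  rewrite (bigD1 a) //= big1 => [|g /negbTE->]; last by rewrite mulr0 mul0r.
  by rewrite !eqxx oppr0 zsum_char0r !addr0 !mulr1.
rewrite /inv_fourier.
rewrite (eq_bigr (fun x => #|{: zsum n}|%:R^-1 * al * zsum_char g x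
    + #|{: zsum n}|%:R^-1 * be * zsum_char (g - a) x)) => [|x _]; last first.
  by rewrite fE zsum_charDl !zsum_charNl !(zsum_charC x) zsum_charNl; ring.
rewrite big_split /= -!mulr_sumr !sum_zsum_char subr_eq0.
have c0 := card_zsum_neq0.
by case: (_ == 0); case: (_ == a);
  rewrite ?mulr0n ?mulr1n ?mulr0 ?mulr1 ?addr0 ?add0r //; field.
Qed.

End Characters.

(** The integers [m] with [c * m] integral form a subgroup, and Bezout writes a gcd as an integer
    combination. *)
Lemma gcdn_mul_int (R : archiRealDomainType) (I : finType) (P : pred I)
    (f : I -> int) (c : R) :
  (forall i, P i -> c * (f i)%:~R \is a Num.int) ->
  c * (\big[gcdn/0%N]_(i | P i) `|f i|%N)%:R \is a Num.int.
Proof.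
move=> cf; elim/big_ind: _ => [|k l ck cl|i Pi]; first by rewrite mulr0 rpred0.
  have [u [v e]] := Bezoutz k l.
  rewrite pmulrn -[(gcdn k l)%:Z]/(gcdz k l) -e rmorphD !rmorphM /= mulrDr.
  by rewrite !(mulrCA c) rpredD // rpredM // intr_int.
rewrite natr_absz; case: ger0P => _; last by rewrite rmorphN mulrN rpredN cf.
exact: cf.
Qed.

(** * Spectral form of the transition matrix of a Cayley graph *)

Section CayleyTransition.
Context (R : realType) (r : nat) (n : 'I_r -> nat).
Hypothesis n_ge2 : forall s : 'I_r, (2 <= n s)%N.
Context (S : {set zsum n}).
Hypothesis S_sym : [set - g | g in S] = S.
Implicit Types (x y g h : zsum n).

Local Notation lambda := (cay_eigenvalue R S).
Local Notation chi := (zsum_char R).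

Lemma mem_symN g : (- g \in S) = (g \in S).
Proof.
by rewrite -{1}S_sym; apply/imsetP/idP => [[h hS /oppr_inj->] | gS] //; exists g.
Qed.

Lemma sum_symN (f : zsum n -> R[i]) : \sum_(g in S) f (- g) = \sum_(g in S) f g.
Proof.
rewrite [RHS](reindex_inj oppr_inj) /=; apply: eq_bigl => g.
by rewrite mem_symN.
Qed.

Lemma cay_eigenvalueN x : lambda (- x) = lambda x.
Proof.
rewrite -[RHS](sum_symN (chi x)); apply: eq_bigr => g _.
exact: zsum_charNl.
Qed.

(** Conjugation turns [chi x g] into [chi x (- g)], which only permutes the sum over the symmetric
    set [S]. *)
Lemma cay_eigenvalue_real x : lambda x = (complex.Re (lambda x))%:C.
Proof.
have : (lambda x)^* = lambda x.
  rewrite -[RHS](sum_symN (chi x)) rmorph_sum; apply: eq_bigr => g _.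
  exact: zsum_char_conj.
case: (lambda x) => a b [] /esym/eqP; rewrite -subr_eq0 opprK -mulr2n.
by rewrite mulrn_eq0 /= => /eqP->.
Qed.

(** The neighbours of [g] are the [g - h] with [h] in [S], and [chi x] is multiplicative; hence
    [chi x] is an eigenvector. *)
Lemma cay_eigenP x g :
  \sum_(h | Cay S g h) chi x h = lambda x * chi x g.
Proof.
rewrite -[lambda x](sum_symN (chi x)) mulr_suml.
rewrite (reindex_inj (inj_comp (addrI g) oppr_inj)) /=; apply: eq_big => h.
  by rewrite /Cay opprD opprK addrA subrr add0r.
by rewrite zsum_charDr // mulrC.
Qed.

Lemma adjmx_char x (i : 'I_#|{: zsum n}|) :
  \sum_l adjmx R (Cay S) i l * chi x (enum_val l) = lambda x * chi x (enum_val i).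
Proof.
rewrite -cay_eigenP [RHS]big_mkcond [RHS](reindex (@enum_val _ predT)) /=.
  apply: eq_bigr => l _; rewrite mxE.
  by case: (Cay S _ _); rewrite ?mul1r ?mul0r.
by apply: onW_bij; exact: enum_val_bij.
Qed.

(** Orthogonality expands the identity matrix in characters; each further power applies the
    eigenvector equation once. The scalar [c] will be [0 +i* t]. *)
Lemma adjmx_expr (c : R[i]) k (i j : 'I_#|{: zsum n}|) :
  ((c *: adjmx R (Cay S)) ^+ k) i j =
  \sum_x #|{: zsum n}|%:R^-1 * chi x (enum_val i - enum_val j)
         * (c * lambda x) ^+ k.
Proof.
elim: k i => [|k IH] i.
  rewrite expr0 mxE; under eq_bigr do rewrite expr0 mulr1 zsum_charC.
  rewrite -mulr_sumr sum_zsum_char // subr_eq0 (inj_eq enum_val_inj).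
  by case: eqP => _; rewrite ?mulr0 // mulr1n mulVf // card_zsum_neq0.
rewrite exprS mxE.
under eq_bigr do rewrite IH mulr_sumr.
rewrite exchange_big; apply: eq_bigr => x _ /=.
transitivity (#|{: zsum n}|%:R^-1 * c * (c * lambda x) ^+ k
    * chi x (- enum_val j) * (lambda x * chi x (enum_val i))).
  rewrite -adjmx_char [RHS]mulr_sumr; apply: eq_bigr => l _.
  by rewrite zsum_charDr // [X in X * _]mxE; ring.
by rewrite exprS zsum_charDr //; ring.
Qed.

(** The eigenvalue of the transition matrix on [chi x]. Since [expi] takes a real angle, the real
    part stands for the real number [lambda x]. *)
Definition phase (t : R) x : R[i] := expi (t * complex.Re (lambda x)).

Lemma transition_entry (t : R) (i j : 'I_#|{: zsum n}|) :
  transition (Cay S) t i j =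
  inv_fourier (phase t) (enum_val i - enum_val j).
Proof.
apply: expmx_entry => k; rewrite adjmx_expr; apply: eq_bigr => x _.
rewrite {1}cay_eigenvalue_real; congr (_ * _ ^+ k); simpc.
by apply/eqP; rewrite eq_complex /=; apply/andP; split; apply/eqP; ring.
Qed.

Lemma inv_fourier_phaseN t g :
  inv_fourier (phase t) (- g) = inv_fourier (phase t) g.
Proof.
rewrite /inv_fourier [RHS](reindex_inj oppr_inj) /=; apply: eq_bigr => x _.
by rewrite zsum_charNl // /phase cay_eigenvalueN.
Qed.

(** The entry [(w, v)] depends only on [w - v], so the substitution [w = v + g] removes [v] from the
    equation. *)
Lemma transition_vertexP t (v a : zsum n) (al be : R[i]) :
  transition (Cay S) t *m vertex_vec R v
    = al *: vertex_vec R v + be *: vertex_vec R (v + a) <->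
  forall g, inv_fourier (phase t) g = al * (g == 0)%:R + be * (g == a)%:R.
Proof.
rewrite /vertex_vec -colE; split => [/colP e g|e].
  move: (e (enum_rank (v + g))); rewrite [LHS]mxE transition_entry !mxE !enum_rankK.
  rewrite addrAC subrr add0r eqxx !andbT !(inj_eq enum_rank_inj) => ->.
  by rewrite (inj_eq (addrI v)) -{2}[v]addr0 (inj_eq (addrI v)).
apply/colP => i; rewrite [LHS]mxE transition_entry !mxE enum_rankK e !andbT.
rewrite -[i in RHS]enum_valK !(inj_eq enum_rank_inj).
by rewrite subr_eq0 subr_eq [a + v]addrC.
Qed.

End CayleyTransition.

(** * Elements with [a + a = 0] and the pairs in [Npairs a] *)

Section OrderTwo.
Context (R : realType) (r : nat) (n : 'I_r -> nat).
Hypothesis n_ge2 : forall s : 'I_r, (2 <= n s)%N.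
Context (a : zsum n).
Hypothesis a2 : a + a = 0.
Implicit Types (x y : zsum n).

Local Notation chi := (zsum_char R).

Lemma val_order2 s : a s != 0 -> n s = (2 * a s)%N.
Proof.
move=> as0; have : ((a + a)%R s : nat) = 0%N by rewrite a2 zsum0E.
(* The quotient of [2 * a s] by [n s] is neither 0, as [a s] is positive, nor at least 2, as
   [a s < n s]. *)
rewrite val_zsumD // addnn -mul2n => /eqP; rewrite -/(dvdn _ _) => /dvdnP[[|[|k]] e].
- by move: as0; rewrite -val_eqE /=; case: (a s : nat) e.
- by rewrite e mul1n.
- have := val_zsum_lt n_ge2 a s; nia.
Qed.

(** The exponent of the sign [chi x a]: where [a s != 0], [n s = 2 * a s] makes the factor at [s]
    equal to [expi pi ^+ x_s]. *)
Definition half_weight x : nat := \sum_(s < r | a s != 0) x s.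

Lemma zsum_char_order2 x : chi x a = (-1) ^+ half_weight x.
Proof.
rewrite expr_sum [RHS]big_mkcond; apply: eq_bigr => s _.
have [->|as0] := eqVneq; first by rewrite mulr0 expi0.
have e : (n s)%:R = 2 * (a s)%:R :> R by rewrite -natrM -val_order2.
have : (a s)%:R != 0 :> R by rewrite pnatr_eq0.
by rewrite -expi_pi -expiMn -[pi *+ _]mulr_natr e => ?; congr expi; field.
Qed.

(** The factor [2 a_s / n_s] is 1 on the support of [a] and 0 elsewhere. The weight in [Npairs] is
    thus an integer, even exactly when the two signs agree. *)
Lemma half_weightE x y :
  wt (fun s => 2 * (a s : nat)%:R * ((x s : nat)%:R - (y s : nat)%:R) / (n s)%:R)
    = ((half_weight x)%:Z - (half_weight y)%:Z)%:~R.
Proof.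
rewrite rmorphB /= -!pmulrn !natr_sum -sumrB [RHS]big_mkcond.
apply: eq_bigr => s _; have [->|as0] := eqVneq; first by rewrite mulr0 !mul0r.
have -> : (n s)%:R = 2 * (a s)%:R :> rat by rewrite -natrM -val_order2.
have : (a s)%:R != 0 :> rat by rewrite pnatr_eq0.
by move=> ?; field.
Qed.

Lemma Npairs_order2 x y :
  ((x, y) \in Npairs a) = dotgt x y && (chi x a == chi y a).
Proof.
rewrite inE /= half_weightE /even_integer intr_int numq_int /=; congr (_ && _).
rewrite !zsum_char_order2 -signr_odd -[in RHS](signr_odd _ (half_weight y)).
rewrite (inj_eq signr_inj) -[LHS]/(2 %| `|_|)%N.
by lia.
Qed.

(** The least coordinate where [x] and [y] differ decides. Hence [Npairs a] meets every pair of
    distinct elements of equal sign, in one of the two orders. *)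
Lemma dotgt_total x y : x != y -> dotgt x y || dotgt y x.
Proof.
move=> xy; have /existsP[i0 xyi0] : [exists i, x i != y i].
  apply: contraNT xy => /existsPn xy; apply/eqP/ffunP => i.
  by apply/eqP; move: (xy i); rewrite negbK.
case: (@arg_minnP _ i0 (fun i => x i != y i) (fun i : 'I_r => i : nat) xyi0) => i xyi min_i.
have eq_lt (j : 'I_r) : (j < i)%N -> x j == y j.
  by apply: contraLR => /min_i; rewrite leqNgt.
move: xyi; rewrite -val_eqE neq_ltn => /orP[lt_xy|lt_yx]; apply/orP; [right|left].
  apply/existsP; exists i; rewrite lt_xy andbT.
  by apply/forallP => j; apply/implyP; rewrite eq_sym; exact: eq_lt.
apply/existsP; exists i; rewrite lt_yx andbT.
by apply/forallP => j; apply/implyP; exact: eq_lt.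
Qed.

(** * The revival criterion when [a + a = 0] *)

Section Revival.
Context (S : {set zsum n}).
Hypothesis S_sym : [set - g | g in S] = S.
Local Notation lambda := (cay_eigenvalue R S).

(** As the eigenvalues are real, both sides say that [t] times their difference is a multiple of
    [2 * pi]. *)
Lemma phase_eqP (t : R) x y :
  phase S t x = phase S t y <->
  exists k : int, (t / (2 * pi))%:C * (lambda x - lambda y) = k%:~R.
Proof.
have p0 : 2 * pi != 0 :> R by rewrite mulf_neq0 // gt_eqF // pi_gt0.
set d := complex.Re (lambda x) - complex.Re (lambda y).
have -> : (t / (2 * pi))%:C * (lambda x - lambda y) = (t / (2 * pi) * d)%:C.
  have real z := cay_eigenvalue_real R n_ge2 S_sym z.
  by rewrite {1}(real x) {1}(real y) -rmorphB -rmorphM.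
have phE : phase S t x = phase S t y <-> expi (t * d) = 1.
  rewrite /d mulrBr expiD expiN /phase.
  have e0 : expi (t * complex.Re (lambda y)) != 0.
    by rewrite -normr_eq0 expi_normr oner_eq0.
  split=> [->|/(congr1 ( *%R^~ (expi (t * complex.Re (lambda y))))) /=].
    by rewrite divff.
  by rewrite divfK // mul1r.
rewrite phE; split=> [/expi_eq1[k e]|[k]].
  exists k; rewrite -(rmorph_int (real_complex R)); congr (_%:C).
  by rewrite mulrAC e mulrAC divff // mul1r.
rewrite -(rmorph_int (real_complex R)) => /complexI e.
rewrite (_ : t * d = 2 * pi * k%:~R) ?expi_2piZ // -e.
by rewrite [t / _ * _]mulrAC [RHS]mulrC divfK.
Qed.

Lemma fractional_revival_order2 (t : R) (v : zsum n) : a != 0 ->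
  fractional_revival (Cay S) t v (v + a) <->
  (forall x y, (x, y) \in Npairs a -> exists k : int,
     (t / (2 * pi))%:C * (lambda x - lambda y) = k%:~R).
Proof.
move=> a0; have aN : - a = a by apply/eqP; rewrite eq_sym -addr_eq0 a2.
split=> [[_ [al [be [_]]]]|H].
  move=> /(transition_vertexP n_ge2 S_sym) /(inv_fourier_eq n_ge2) E x y.
  by rewrite Npairs_order2 => /andP[_ /eqP c]; apply/phase_eqP; rewrite !E aN c.
split; first by move/eqP; rewrite -{1}[v]addr0 (inj_eq (addrI v)) eq_sym (negbTE a0).
have phE x y : chi x a = chi y a -> phase S t x = phase S t y.
  move=> c; have [->//|/dotgt_total/orP[xy|yx]] := eqVneq x y.
    by apply/phase_eqP/H; rewrite Npairs_order2 xy c eqxx.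
  by apply/esym/phase_eqP/H; rewrite Npairs_order2 yx c eqxx.
pose p := phase S t 0.
(* The common phase on the level set of sign -1, read off at any member; [phE] makes the choice
   immaterial. The default 1 keeps [q] of modulus 1. *)
pose q : R[i] := if [pick x | chi x a == -1] is Some x then phase S t x else 1.
have pq (w : R[i]) : `|w| = 1 -> w * w^* = 1 by move=> e; rewrite -sqr_normc e expr1n.
have np : p * p^* = 1 by apply: pq; exact: expi_normr.
have nq : q * q^* = 1.
  by apply: pq; rewrite /q; case: pickP => *; rewrite ?normr1 ?expi_normr.
exists ((p + q) / 2), ((p - q) / 2); split.
  have half w : (w / 2)^* = w^* / 2 :> R[i].
    by rewrite rmorphM fmorphV rmorph_nat.
  rewrite !sqr_normc !half raddfD raddfB.
  (* Parallelogram law: the cross terms of [p] and [q] cancel. *)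
  transitivity ((p * p^* + q * q^*) / 2); first by field.
  by rewrite np nq; field.
apply/(transition_vertexP n_ge2 S_sym)/(inv_fourier_eq n_ge2) => x; rewrite aN.
have : chi x a = 1 \/ chi x a = -1.
  by rewrite zsum_char_order2 -signr_odd; case: odd; [right|left].
have c0 : chi 0 a = 1 by rewrite zsum_charC zsum_char0r.
case=> c; rewrite c.
  rewrite (_ : phase S t x = p); last by apply: phE; rewrite c c0.
  by move: (p) (q) => p' q'; field.
rewrite (_ : phase S t x = q); first by move: (p) (q) => p' q'; field.
rewrite /q; case: pickP => [y /eqP cy|/(_ x)]; first by apply: phE; rewrite c cy.
by rewrite c eqxx.
Qed.

End Revival.
End OrderTwo.

(** * Necessity of order two, and the minimal revival time *)

Lemma zsum_order2P (r : nat) (n : 'I_r -> nat) (a : zsum n) :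
  #[a]%g = 2 <-> a != 0 /\ a + a = 0.
Proof.
split=> [a2|[a0 a2]].
  split; first by apply: contra_eqN a2 => /eqP->; rewrite (order1 (zsum n)).
  by have := expg_order a; rewrite a2.
exact: cyclic.nt_prime_order.
Qed.

(* The transition matrix is symmetric, so its entries at differences [a] and
   [- a] agree; if [- a <> a] the latter is 0, which forces beta = 0. *)
Lemma revival_order2_or_periodic (R : realType) (r : nat) (n : 'I_r -> nat)
    (n_ge2 : forall s : 'I_r, (2 <= n s)%N) (S : {set zsum n})
    (S_sym : [set - g | g in S] = S) (t : R) (v a : zsum n) :
  fractional_revival (Cay S) t v (v + a) ->
  a + a = 0 \/ periodic_at (Cay S) t v.
Proof.
move=> [/eqP va [al [be [nab e]]]].
have a0 : a != 0 by apply: contraNneq va => ->; rewrite addr0.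
have F := (transition_vertexP n_ge2 S_sym _ _ _ _ _).1 e.
have [aN|aN] := eqVneq (- a) a; first by left; rewrite -{2}aN subrr.
right; exists al; have b0 : be = 0.
  move: (inv_fourier_phaseN n_ge2 S_sym t a).
  by rewrite !F oppr_eq0 (negbTE a0) (negbTE aN) eqxx !mulr0 !add0r mulr1.
split; last by rewrite e b0 scale0r addr0.
by apply/eqP; rewrite -(@eqrXn2 _ 2) // expr1n -nab b0 normr0 expr0n /= addr0.
Qed.

(** When [v] is periodic at time [t], for instance at [t = 0], revival with [beta = 0] holds towards
    every other vertex, whatever its order; the first hypothesis confines this case to [a + a = 0].
    If [M] were 0, all differences would vanish and every time would be a revival time, so no
    minimum would exist. *)
Theorem theorem1p1 (R : realType) (r : nat) (n : 'I_r -> nat)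
  (n_ge2 : forall s : 'I_r, (2 <= n s)%N)
  (S : {set zsum n})
  (S_zero : (0 : zsum n) \notin S)
  (S_sym : [set - g | g in S] = S)
  (v a : zsum n) (t : R) :
  let lambda := cay_eigenvalue R S in
  let conditions :=
    [/\ #[a]%g = 2%N,
        forall s : 'I_r, a s <> 0 -> ~~ odd (n s)
      & forall x y : zsum n, (x, y) \in Npairs a ->
          exists k : int,
            (t / (2 * pi))%:C * (lambda x - lambda y) = k%:~R] in
  ((periodic_at (Cay S) t v -> a + a = 0) ->
     (fractional_revival (Cay S) t v (v + a) <-> conditions)) /\
  (conditions ->
     forall d : zsum n -> zsum n -> int,
       (forall x y : zsum n, (x, y) \in Npairs a ->
          lambda x - lambda y = (d x y)%:~R) ->
       let M : nat := \big[gcdn/0%N]_(p in Npairs a) `|d p.1 p.2|%N in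
       M <> 0%N ->
       let tmin : R := 2 * pi / M%:R in
       [/\ 0 < tmin,
           fractional_revival (Cay S) tmin v (v + a)
         & forall t' : R, 0 < t' ->
             fractional_revival (Cay S) t' v (v + a) -> tmin <= t']).
Proof.
move=> lambda conditions; have pi0 := pi_gt0 R.
have FRP t' : #[a]%g = 2 -> fractional_revival (Cay S) t' v (v + a) <->
    forall x y : zsum n, (x, y) \in Npairs a -> exists k : int,
      (t' / (2 * pi))%:C * (lambda x - lambda y) = k%:~R.
  by move=> /zsum_order2P[a0 a2]; exact: fractional_revival_order2.
split=> [per|[ord2 _ _] d dE M /eqP M0 tmin].
  split=> [FR|[ord2 _ c]]; last exact/FRP.
  have a2 : a + a = 0.
    by case: (revival_order2_or_periodic n_ge2 S_sym FR).
  have a0 : a != 0 by apply/eqP => e; case: FR => vN _; case: vN; rewrite e addr0.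
  have ord2 : #[a]%g = 2 by apply/zsum_order2P.
  split=> //; last exact/FRP.
  by move=> s /eqP /(val_order2 n_ge2 a2)->; rewrite oddM.
have Mpos : 0 < M%:R :> R by rewrite ltr0n lt0n.
have M1 : M%:R != 0 :> R by rewrite gt_eqF.
have p0 : 2 * pi != 0 :> R by rewrite mulf_neq0 // gt_eqF.
split; first by rewrite divr_gt0 // mulr_gt0.
  apply/FRP => // x y xy; rewrite (dE _ _ xy).
  (* Since [tmin / (2 * pi)] is [1 / M], the required integer is the quotient of [d x y] by [M]. *)
  have : (M %| `|d x y|)%N by exact: (@biggcdn_inf _ (x, y)).
  rewrite -[M]/`|M%:Z|%N -dvdzE => /dvdzP[k ->]; exists k.
  rewrite -!(rmorph_int (real_complex R)) -rmorphM; congr (_%:C).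
  have -> : tmin / (2 * pi) = M%:R^-1 by rewrite /tmin mulrAC divff // mul1r.
  by rewrite rmorphM mulrC; exact: mulfK.
move=> t' t'0 /(FRP _ ord2) c.
(* By Bezout integrality passes from the differences to their gcd [M]; a positive integer is at
   least 1, which is the bound on [t']. *)
have : t' / (2 * pi) * M%:R \is a Num.int.
  apply: gcdn_mul_int => -[x y] xy; have [k] := c _ _ xy; rewrite (dE _ _ xy).
  rewrite -!(rmorph_int (real_complex R)) -rmorphM => /complexI->.
  exact: intr_int.
have t'M0 : 0 < t' / (2 * pi) * M%:R by rewrite mulr_gt0 // divr_gt0 // mulr_gt0.
move=> /intrP[k e]; move: t'M0; rewrite e ltr0z => k0.
have : 1 <= t' / (2 * pi) * M%:R by rewrite e ler1z.
by rewrite mulrAC ler_pdivlMr ?mulr_gt0 // mul1r /tmin ler_pdivrMr.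
Qed.
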